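(* There exists a compact subset $\mathfrak{h}^{**}\subset\mathfrak{h}^{*}$ such that every point of $\mathfrak{h}^{*}\setminus\mathfrak{h}^{**}$ gives rise only to convex discs whose packing density is greater than that of the smoothed octagon; that is, for every $z\in\mathfrak{h}^{*}\setminus\mathfrak{h}^{**}$ and every $K\in\mathfrak{K}_{bal}$ in circle representation which has $H_K(z)$ as a critical hexagon, $\delta(K)>\delta_{oct}$.
   Context: A disc is a compact subset of $\mathbb{R}^2$; $\mathfrak{K}_{ccs}$ is the class of convex discs (with interior) centrally symmetric about the origin. $\delta(K)$ is the best packing density of $K$: the supremum of the densities of packings of the plane by congruent copies of $K$. The packing density of the smoothed octagon is $\delta_{oct}=\frac{8-\sqrt{32}-\ln 2}{\sqrt8-1}$. A lattice $\mathbf{L}\subset\mathbb{R}^2$ is $K$-admissible if no point of $\mathbf{L}$ other than $0$ lies in the interior of $K$; it is critical for $K$ if its determinant (covolume) is minimal among $K$-admissible lattices. $K$ is irreducible if every boundary point of $K$ lies on a critical lattice of $K$. $\mathfrak{K}_{bal}\subset\mathfrak{K}_{ccs}$ is the set of irreducible discs whose boundary has a unique support line at each point and each of whose boundary points lies on a unique critical lattice. Each point $E_0\in\partial K$ then determines six lattice points $\pm E_0,\pm E_1,\pm E_2$ of a critical lattice on $\partial K$, with $E_0-E_1+E_2=0$; the support lines of $K$ at these six points bound a hexagon, called a critical hexagon of $K$; it is a minimal-area hexagon circumscribing $K$, with each side bisected at its contact point. Let $e_j^*=(\cos(\pi j/3),\sin(\pi j/3))$, $j\in\mathbb{Z}/6\mathbb{Z}$.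 $K$ is in circle representation if the points $e_j^*$ lie on $\partial K$ and form such a six-tuple of points (so the critical hexagons of $K$ have area $\sqrt{12}$). $\mathfrak{h}$ is the upper half-plane, and the star domain is $\mathfrak{h}^*=\{x+iy\in\mathfrak{h}: -\tfrac1{\sqrt3}<x<\tfrac1{\sqrt3},\ x^2+y^2>\tfrac13\}$. For $z=x+iy\in\mathfrak{h}$ let $X_z=\begin{pmatrix}x/y&-(x^2+y^2)/y\\1/y&-x/y\end{pmatrix}$. For $z\in\mathfrak{h}^*$, $H_K(z)$ is the hexagon bounded by the six lines $\{e_j^*+sX_ze_j^*: s\in\mathbb{R}\}$; ''$K$ has $H_K(z)$ as a critical hexagon'' means these six lines are the support lines of $K$ at the points $e_j^*$. *)

(* Defs.v *)
From HB Require Import structures.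
From mathcomp Require Import all_boot all_order all_algebra.
From mathcomp Require Import all_classical all_reals all_analysis.

Set Implicit Arguments.
Unset Strict Implicit.
Unset Printing Implicit Defensive.

Import Order.TTheory GRing.Theory Num.Theory.
Import numFieldNormedType.Exports.

Local Open Scope classical_set_scope.
Local Open Scope ring_scope.

(** MathComp-Analysis, over an arbitrary [R : realType].  The plane is a pair
    of copies of [R^o], so that it carries the product topology, the [R]-module
    structure used by [convex_set], and the product Lebesgue measure. *)
Notation plane R := (R^o * R^o)%type.

Section Plane.
Variable R : realType.
Implicit Types (p q u v : plane R) (A K L : set (plane R)).

Definition edist p q : R :=
  Num.sqrt ((p.1 - q.1) ^+ 2 + (p.2 - q.2) ^+ 2).

Definition det2 u v : R := u.1 * v.2 - u.2 * v.1.

Definition area A : \bar R :=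
  ((@lebesgue_measure R) \x (@lebesgue_measure R))%E A.

Definition boundary A : set (plane R) := closure A `\` interior A.

Definition line p v : set (plane R) := [set p + s *: v | s in [set: R]].

(** [l] is a support line of [K] at [p].  The inequality puts [K] in one of the
    two closed half-planes of [l]; replacing [v] by [- v] exchanges them. *)
Definition support_line K p (l : set (plane R)) : Prop :=
  K p /\
  exists v, [/\ v != 0, l = line p v & forall q, K q -> 0 <= det2 v (q - p)].

Definition ccs K : Prop :=
  [/\ compact K, convex_set (K : set (convex_lmodType (plane R))),
      interior K !=set0 & forall p, K p -> K (- p)].

(** Reflections are allowed, as isometries need not preserve orientation. *)
Definition congruent K A : Prop :=
  exists f : plane R -> plane R,
    (forall p q, edist (f p) (f q) = edist p q) /\ A = f @` K.

Definition packing K (P : set (set (plane R))) : Prop :=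
  (forall A, P A -> congruent K A) /\ trivIset P (@interior (plane R)).

Definition edisc (r : R) : set (plane R) := [set p | edist p 0 <= r].

(** The upper density: the density itself whenever the limit exists. *)
Definition density (P : set (set (plane R))) : \bar R :=
  limf_esup (fun r : R =>
    area ((\bigcup_(A in P) A) `&` edisc r) / area (edisc r))%E +oo.

Definition packing_density K : \bar R :=
  ereal_sup [set density P | P in packing K].

(** The packing density of the smoothed octagon, given by its closed form. *)
Definition delta_oct : R :=
  (8 - Num.sqrt 32 - ln 2) / (Num.sqrt 8 - 1).

Definition lattice_basis L u v : Prop :=
  det2 u v != 0 /\ L = [set p | exists m n : int, p = u *~ m + v *~ n].

Definition lattice L : Prop := exists u v, lattice_basis L u v.

(** The set is a singleton when [L] is a lattice, [|det2 u v|] being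
    independent of the basis. *)
Definition covolume L : R :=
  xget 0 [set d | exists u v, lattice_basis L u v /\ d = `|det2 u v|].

Definition admissible K L : Prop :=
  lattice L /\ forall p, L p -> interior K p -> p = 0.

Definition critical K L : Prop :=
  admissible K L /\ forall L', admissible K L' -> covolume L <= covolume L'.

Definition irreducible K : Prop :=
  forall p, boundary K p -> exists L, critical K L /\ L p.

Definition balanced K : Prop :=
  [/\ ccs K, irreducible K,
      forall p, boundary K p -> exists! l, support_line K p l
    & forall p, boundary K p -> exists! L, critical K L /\ L p].

Definition estar (j : 'I_6) : plane R :=
  (cos (pi * j%:R / 3), sin (pi * j%:R / 3)).

(** With [E_j = estar j] for [j = 0, 1, 2], the six points [±E_j] are the
    [estar j]; the relation [E_0 - E_1 + E_2 = 0] then holds by itself. *)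
Definition circle_representation K : Prop :=
  exists L, critical K L /\ forall j, boundary K (estar j) /\ L (estar j).

(** The star domain; [z] is the complex number [z.1 + i z.2]. *)
Definition star_domain : set (plane R) :=
  [set z | [/\ 0 < z.2, - (1 / Num.sqrt 3) < z.1, z.1 < 1 / Num.sqrt 3
             & 1 / 3 < z.1 ^+ 2 + z.2 ^+ 2]].

(** The matrix [X_z] acting on column vectors. *)
Definition Xact (z p : plane R) : plane R :=
  ((z.1 / z.2) * p.1 - ((z.1 ^+ 2 + z.2 ^+ 2) / z.2) * p.2,
   (1 / z.2) * p.1 - (z.1 / z.2) * p.2).

(** The line carrying the side of the hexagon [H_K(z)] through [estar j]. *)
Definition hexagon_side (z : plane R) (j : 'I_6) : set (plane R) :=
  line (estar j) (Xact z (estar j)).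

Definition has_critical_hexagon K (z : plane R) : Prop :=
  forall j, support_line K (estar j) (hexagon_side z j).

End Plane.

Arguments delta_oct R : clear implicits.
Arguments star_domain R : clear implicits.

(* Main.v *)
Require Import Defs.
From mathcomp Require Import all_boot all_order all_algebra.
From mathcomp Require Import all_classical all_reals all_analysis.
From mathcomp Require Import measurable_realfun ring lra zify.
Import Order.TTheory GRing.Theory Num.Theory.
Import numFieldNormedType.Exports.
Local Open Scope classical_set_scope.
Local Open Scope ring_scope.

Set Implicit Arguments.
Unset Strict Implicit.
Unset Printing Implicit Defensive.

(** Idea of the proof.  The six support lines of [K] given by [z] form three
    strips symmetric about the origin, and any two of them cut out a
    parallelogram [P] containing [K].  In the coordinates in which [P] is the
    square $[-1,1]^2$, the critical lattice spanned by the two contact points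
    has determinant $1 - \epsilon$, where $\epsilon$ is the squared cosine of
    the angle between these points for the quadratic form attached to [z]
    ([star_form]).  Near the frontier of the star domain, and also far up in
    it, one of the three parallelograms has a tiny $\epsilon$: the critical
    hexagon degenerates to a parallelogram.

    Criticality then forces [K] to fill [P].  If some line parallel to a
    diagonal of [P] cut a corner triangle of legs $2h$ off [K], then [K] would
    lie in the hexagon obtained by truncating two opposite corners of [P]; the
    lattice through the midpoints of the sides of that hexagon is admissible
    ([truncated_admissible]) and has normalized determinant $1 - h^2$.  For
    $h^2 > \epsilon$ this contradicts the minimality of the critical lattice.
    So [K] comes close to the four corners of [P] and, being convex, contains
    $(1-2h)P$ ([shrunk_parallelogram_sub]).

    Since the translates of [P] by a lattice tile the plane, the same
    translates of [K] form a packing, whose density is at least $(1-2h)^2$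
    ([packing_density_ge]).  With $h = 1/200$ this is $0.9801$, whereas
    [delta_oct] is below $0.97$.

    Writing $r, s, t$ for the values of the form at consecutive contact points,
    the form is $r+t$, $r+s$, $s+t$, $r+t$ at the points [estar 0], ...,
    [estar 3], the star domain is $r, s, t > 0$, and $r + t = 1$.  The three
    parallelograms have $\epsilon$ equal to $r^2/((r+t)(r+s))$,
    $s^2/((r+s)(s+t))$ and $t^2/((s+t)(r+t))$, and one of these is less than
    $h^2$ unless $r, s, t \geq h^2$ and $s \leq h^{-2}$, conditions that
    define the compact set [star_core]. *)

(** * Planar lattices *)

Lemma mulz_pair (R : realType) (u : plane R) (m : int) :
  u *~ m = (u.1 * m%:~R, u.2 * m%:~R) :> plane R.
Proof.
have h (n : nat) : u *+ n = (u.1 * n%:R, u.2 * n%:R) :> plane R.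
  elim: n => [|n IH]; first by rewrite mulr0n !mulr0.
  by rewrite mulrS IH; congr (_, _); rewrite -add1n natrD mulrDr mulr1.
case: m => n; first exact: h.
by rewrite NegzE mulrNz -pmulrn h; congr (_, _); rewrite /= mulrNz mulrN.
Qed.

Lemma combz_pair (R : realType) (u v : plane R) (m n : int) :
  u *~ m + v *~ n =
  (u.1 * m%:~R + v.1 * n%:~R, u.2 * m%:~R + v.2 * n%:~R) :> plane R.
Proof. by rewrite !mulz_pair. Qed.

Lemma lattice_basis_mem (R : realType) (L : set (plane R)) u v :
  lattice_basis L u v -> L u /\ L v.
Proof.
move=> [_ ->]; split.
  by exists 1, 0; rewrite mulr1z mulr0z addr0.
by exists 0, 1; rewrite mulr1z mulr0z add0r.
Qed.

Lemma lattice_det_multiple (R : realType) (L : set (plane R)) u v p q :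
  lattice_basis L u v -> L p -> L q ->
  exists k : int, det2 p q = det2 u v * k%:~R.
Proof.
move=> [_ ->] [m [n ->]] [m' [n' ->]]; exists (m * n' - n * m').
rewrite !combz_pair /det2 /= rmorphB !rmorphM /=; ring.
Qed.

(** The determinants of two bases of a lattice are integer multiples of each
    other, so they agree up to sign. *)
Lemma covolume_basis (R : realType) (L : set (plane R)) u v :
  lattice_basis L u v -> covolume L = `|det2 u v|.
Proof.
move=> Luv; apply: xget_subset1; first by exists u, v.
suff H u1 v1 u2 v2 : lattice_basis L u1 v1 -> lattice_basis L u2 v2 ->
    `|det2 u1 v1| = `|det2 u2 v2|.
  by move=> _ _ [u1 [v1 [h1 ->]]] [u2 [v2 [h2 ->]]]; exact: H.
move=> h1 h2; have [a1 b1] := lattice_basis_mem h1.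
have [a2 b2] := lattice_basis_mem h2.
have [k ek] := lattice_det_multiple h1 a2 b2.
have [l el] := lattice_det_multiple h2 a1 b1.
have [d0 _] := h1.
have : k * l = 1.
  apply: (@intr_inj R); rewrite intrM /=.
  by apply: (mulfI d0); rewrite mulrA -ek -el mulr1.
move=> kl; have : k \is a GRing.unit by apply/unitrP; exists l; rewrite mulrC kl.
rewrite qualifE /= => /orP [] /eqP ek1; rewrite ek ek1 /=.
  by rewrite mulr1.
by rewrite mulrN1 normrN.
Qed.

(** * Symmetric convex discs *)

Lemma convex_comb (R : realType) (K : set (plane R)) (p q : plane R) (t : R) :
  ccs K -> K p -> K q -> 0 <= t <= 1 ->
  K (t * p.1 + (1 - t) * q.1, t * p.2 + (1 - t) * q.2).
Proof.
move=> [_ cK _ _] Kp Kq t01.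
have /cK : (p : convex_lmodType (plane R)) \in K by exact/mem_set.
move=> /(_ q (Itv01 (andP t01).1 (andP t01).2)).
by move=> /(_ (mem_set Kq)) /set_mem.
Qed.

Lemma nbhs_plane (R : realType) (A : set (plane R)) p :
  nbhs p A <-> exists2 e : R, 0 < e &
    forall q : plane R, `|q.1 - p.1| < e -> `|q.2 - p.2| < e -> A q.
Proof.
split.
  move=> /nbhs_ballP [e /= e0 sA]; exists e => // q h1 h2; apply: sA.
  by split; rewrite -ball_normE /= distrC.
move=> [e e0 sA]; apply/nbhs_ballP; exists e => //= q [].
by rewrite -!ball_normE /= => h1 h2; apply: sA; rewrite distrC.
Qed.

Lemma ccs_nbhs0 (R : realType) (K : set (plane R)) :
  ccs K -> nbhs (0 : plane R) K.
Proof.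
move=> cK; have [_ _ [p /nbhs_plane[e e0 sK]] symK] := cK.
apply/nbhs_plane; exists (e / 2); first by rewrite divr_gt0.
move=> q; rewrite !subr0 => h1 h2.
have Kq : K (p.1 + 2 * q.1, p.2 + 2 * q.2).
  by apply: sK; rewrite /= addrC addKr normrM ger0_norm// mulrC -ltr_pdivlMr.
have Kp : K (- p) by apply: symK; apply: sK; rewrite subrr normr0.
have := @convex_comb R K _ _ (1 / 2) cK Kq Kp; case: q {h1 h2 Kq} => q1 q2 /=.
rewrite [X in K X](_ : _ = (q1, q2)); first by apply; lra.
by congr pair; field.
Qed.

(** A point $q$ near $tk$ is the combination $tk + (1-t)w$ with
    $w = (q-tk)/(1-t)$, and $w$ is near the origin, hence in [K]. *)
Lemma ccs_shrink_interior (R : realType) (K : set (plane R)) (k : plane R)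
    (t : R) :
  ccs K -> K k -> 0 <= t < 1 -> interior K (t * k.1, t * k.2).
Proof.
move=> cK Kk /andP[t0 t1]; have /nbhs_plane[e e0 sK] := ccs_nbhs0 cK.
have t1' : 0 < 1 - t by rewrite subr_gt0.
apply/nbhs_plane; exists (e * (1 - t)); first by rewrite mulr_gt0.
move=> q /= h1 h2.
have Kw : K ((q.1 - t * k.1) / (1 - t), (q.2 - t * k.2) / (1 - t)).
  by apply: sK; rewrite /= subr0 normrM normfV (gtr0_norm t1') ltr_pdivrMr.
have := @convex_comb R K k _ t cK Kk Kw; case: q {h1 h2 Kw} => q1 q2 /=.
rewrite [X in K X](_ : _ = (q1, q2)); first by apply; rewrite t0 ltW.
by congr pair; field; rewrite gt_eqF.
Qed.

(** From an interior point one can still move a little in the direction in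
    which the linear form [det2 a] increases. *)
Lemma interior_strip (R : realType) (K : set (plane R)) (a p : plane R) (c : R) :
  a != 0 -> (forall q, K q -> det2 a q <= c) -> interior K p -> det2 a p < c.
Proof.
move=> a0 aK /nbhs_plane[e e0 sK].
(* The step $t(-a_2, a_1)$ raises [det2 a] by $t|a|^2$; [t] is chosen so that it
   is shorter than [e] in the supremum norm. *)
pose M := `|a.1| + `|a.2| + 1.
have M0 : 0 < M by rewrite ltr_wpDl // addr_ge0.
pose t := e / M.
have t0 : 0 < t by rewrite divr_gt0.
have tM : t * M = e by rewrite /t divfK // gt_eqF.
have n1 := normr_ge0 a.1; have n2 := normr_ge0 a.2.
have Kw : K (p.1 - t * a.2, p.2 + t * a.1).
  apply: sK => /=; rewrite [X in `|X|]addrC addKr ?normrN normrM (gtr0_norm t0).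
    by rewrite -tM ltr_pM2l // /M; lra.
  by rewrite -tM ltr_pM2l // /M; lra.
apply: lt_le_trans (aK _ Kw); rewrite /det2 /= -subr_gt0.
rewrite [ltRHS](_ : _ = t * (a.1 ^+ 2 + a.2 ^+ 2)); last by ring.
apply: mulr_gt0 => //; rewrite lt_neqAle addr_ge0 ?sqr_ge0 // andbT eq_sym.
rewrite paddr_eq0 ?sqr_ge0 // !sqrf_eq0; apply: contra_neqN a0.
by case: a {aK M M0 t t0 tM n1 n2 Kw} => a1 a2 /= /andP[/eqP-> /eqP->].
Qed.

(** * The critical lattice in circle representation *)

(** With $\theta = \pi/3$, the relation $\cos 2\theta = -\cos\theta$ reads
    $(2\cos\theta - 1)(\cos\theta + 1) = 0$. *)
Lemma cos_pi3 (R : realType) : cos (pi / 3 : R) = 1 / 2.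
Proof.
have p0 : 0 < (pi : R) by exact: pi_gt0.
have c0 : 0 < cos (pi / 3 : R) by apply: cos_gt0_pihalf; lra.
have e : cos ((pi / 3 : R) *+ 2) = - cos (pi / 3).
  by rewrite -cosN -cosDpi cosN -(cosN (_ *+ 2)) -(cosD2pi (- _)); congr cos; field.
move: e; rewrite cos_mulr2n => e; nra.
Qed.

Lemma sin_pi3 (R : realType) : sin (pi / 3 : R) = Num.sqrt 3 / 2.
Proof.
have p0 : 0 < (pi : R) by exact: pi_gt0.
have s0 : 0 < sin (pi / 3 : R) by apply: sin_gt0_pihalf; lra.
have s3 : 0 <= Num.sqrt 3 :> R by exact: sqrtr_ge0.
have q3 : Num.sqrt 3 ^+ 2 = 3 :> R by rewrite sqr_sqrtr // ler0n.
have e := sin2cos2 (pi / 3 : R); rewrite cos_pi3 in e; nra.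
Qed.

Lemma estar0 (R : realType) : estar R (@Ordinal 6 0 isT) = (1, 0).
Proof. by rewrite /estar /= mulr0 mul0r cos0 sin0. Qed.

Lemma estar1 (R : realType) :
  estar R (@Ordinal 6 1 isT) = (1 / 2, Num.sqrt 3 / 2).
Proof. by rewrite /estar /= mulr1 cos_pi3 sin_pi3. Qed.

Lemma estar2 (R : realType) :
  estar R (@Ordinal 6 2 isT) = (- (1 / 2), Num.sqrt 3 / 2).
Proof.
have e : pi * 2 / 3 = - (pi / 3) + pi :> R by field.
by rewrite /estar /= e cosDpi sinDpi cosN sinN opprK cos_pi3 sin_pi3.
Qed.

Lemma estar3 (R : realType) : estar R (@Ordinal 6 3 isT) = (- 1, 0).
Proof. by rewrite /estar /= mulfK ?pnatr_eq0 // cospi sinpi. Qed.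

Lemma lattice_sub (R : realType) (L : set (plane R)) p q r (m n : int) :
  lattice L -> L p -> L q -> L r -> L (p - (q *~ m + r *~ n)).
Proof.
move=> [u [v [_ ->]]] [a [b ->]] [a' [b' ->]] [a'' [b'' ->]].
exists (a - a' * m - a'' * n), (b - b' * m - b'' * n).
rewrite !combz_pair; congr pair; rewrite /= !rmorphB !rmorphM /=; ring.
Qed.

(** Every class modulo the lattice spanned by [estar 0] and [estar 1] has a
    representative $a e_0 - b e_1$ with $0 \leq a, b < 1$, which lies in the
    interior of the hexagon with vertices [estar j], hence of [K].  So an
    admissible lattice containing $e_0$ and $e_1$ has no other class. *)
Lemma hexagon_lattice_unique (R : realType) (K L : set (plane R)) :
  let s := Num.sqrt 3 in
  ccs K -> K (1, 0) -> K (1 / 2, s / 2) -> K (- (1 / 2), s / 2) ->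
  admissible K L -> L (1, 0) -> L (1 / 2, s / 2) ->
  forall p, L p -> exists m n : int,
    p = (m%:~R + 1 / 2 * n%:~R, s / 2 * n%:~R).
Proof.
move=> s cK K0 K1 K2 [latL admL] L0 L1 p Lp.
have [_ _ _ symK] := cK; have s0 : 0 < s by rewrite sqrtr_gt0.
have K1' : K (- (1 / 2), - (s / 2)) by exact: symK K1.
have K2' : K (1 / 2, - (s / 2)).
  by rewrite -[X in K (X, _)]opprK; exact: symK K2.
pose x := p.1 - p.2 / s; pose y := 2 * p.2 / s.
pose m := Num.floor x; pose n := Num.ceil y; exists m, n.
pose a := x - m%:~R; pose b := n%:~R - y.
have a01 : 0 <= a < 1.
  by rewrite /a subr_ge0 floor_le ltrBlDr addrC -[X in _ + X]/(1%:~R) -intrD floorD1_gt.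
have b01 : 0 <= b < 1.
  by rewrite /b subr_ge0 ceil_ge /=; have := ceilB1_lt y; rewrite intrB -/n; lra.
have e : p - ((1, 0) *~ m + (1 / 2, s / 2) *~ n) = (a - b / 2, - (b * s / 2)).
  rewrite combz_pair; apply: injective_projections => /=.
    by rewrite /a /b /x /y; field; rewrite gt_eqF.
  by rewrite /a /b /x /y; field; rewrite gt_eqF.
have /admL H := @lattice_sub R L p (1, 0) (1 / 2, s / 2) m n latL Lp L0 L1.
suff /H/eqP : interior K (p - ((1, 0) *~ m + (1 / 2, s / 2) *~ n)).
  rewrite subr_eq0 => /eqP ->; rewrite combz_pair /=; congr pair; ring.
rewrite e {H e}.
(* The point $a e_0 - b e_1$ lies on the segment that joins $a e_0$ to
   $a(e_0 - e_1)$ if $b \leq a$, and $-b e_1$ to $b(e_0 - e_1)$ otherwise. *)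
have [ab|ba] := leP b a.
  have [a0|a0] := eqVneq a 0.
    have b0 : b = 0 by lra.
    rewrite a0 b0 !mul0r subr0 oppr0.
    have := @ccs_shrink_interior R K _ 0 cK K0.
    by rewrite !mul0r; apply; rewrite lexx ltr01.
  have := @convex_comb R K _ _ (b / a) cK K2' K0; rewrite /=.
  have a0' : 0 < a by lra.
  rewrite divr_ge0 ?ler_pdivrMr ?mul1r ?ab //; try lra.
  move=> /(_ isT) /(ccs_shrink_interior cK) /(_ a01) /=.
  by congr interior; congr pair; field.
have b0 : 0 < b by lra.
have := @convex_comb R K _ _ (a / b) cK K2' K1'; rewrite /=.
rewrite divr_ge0 ?ler_pdivrMr ?mul1r ?(ltW ba) //; try lra.
move=> /(_ isT) /(ccs_shrink_interior cK) /(_ b01) /=.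
by congr interior; congr pair; field; rewrite gt_eqF.
Qed.

(** The critical lattice lies in the hexagonal one, so its determinant is a
    nonzero integer multiple of $\sqrt 3/2$. *)
Lemma critical_covolume (R : realType) (K : set (plane R)) :
  ccs K -> circle_representation K ->
  forall L, admissible K L -> Num.sqrt 3 / 2 <= covolume L.
Proof.
move=> cK [L [[admL minL] eL]] L' /minL; apply: le_trans.
have [cpt _ _ _] := cK.
have s0 : 0 < Num.sqrt 3 :> R by rewrite sqrtr_gt0.
have clK : closed K by apply: compact_closed => //; exact: norm_hausdorff.
have bK p : boundary K p -> K p by move=> [h _]; exact: clK.
have [/bK K0 L0] := eL (@Ordinal 6 0 isT); rewrite estar0 in K0 L0.
have [/bK K1 L1] := eL (@Ordinal 6 1 isT); rewrite estar1 in K1 L1.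
have [/bK K2 _] := eL (@Ordinal 6 2 isT); rewrite estar2 in K2.
have [[u [v Luv]] _] := admL; rewrite (covolume_basis Luv).
have [Lu Lv] := lattice_basis_mem Luv.
have H := hexagon_lattice_unique cK K0 K1 K2 admL L0 L1.
have [m [n eu]] := H _ Lu; have [m' [n' ev]] := H _ Lv.
have [d0 _] := Luv.
have e : det2 u v = Num.sqrt 3 / 2 * (m * n' - n * m')%:~R.
  by rewrite eu ev /det2 /= intrB !intrM /=; field.
rewrite e normrM gtr0_norm ?divr_gt0 // ler_peMr ?divr_ge0 ?(ltW s0) //.
rewrite -intr_norm ler1z -gtz0_ge1 normr_gt0.
by apply: contra_neq d0 => k0; rewrite e k0 mulr0.
Qed.

(** * Discs inside a nearly critical parallelogram *)

(** The point at which the linear forms [det2 a] and [det2 b] take the values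
    [s] and [t]. *)
Definition strip_point (R : realType) (a b : plane R) (s t : R) : plane R :=
  ((s * b.1 - t * a.1) / det2 a b, (s * b.2 - t * a.2) / det2 a b).

Section StripPoint.
Variables (R : realType) (a b : plane R).
Hypothesis ab0 : det2 a b != 0.

Lemma det2_strip_pointl s t : det2 a (strip_point a b s t) = s.
Proof. by move: ab0; rewrite /strip_point /det2 /= => h; field. Qed.

Lemma det2_strip_pointr s t : det2 b (strip_point a b s t) = t.
Proof. by move: ab0; rewrite /strip_point /det2 /= => h; field. Qed.

Lemma det2_strip_point s t s' t' :
  det2 (strip_point a b s t) (strip_point a b s' t') =
  (s * t' - t * s') / det2 a b.
Proof. by move: ab0; rewrite /strip_point /det2 /= => h; field. Qed.

Lemma strip_point_inj p q : det2 a p = det2 a q -> det2 b p = det2 b q -> p = q.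
Proof.
move=> ea eb; apply: injective_projections; apply: (mulfI ab0).
  have -> : det2 a b * p.1 = b.1 * det2 a p - a.1 * det2 b p by rewrite /det2; ring.
  by rewrite ea eb /det2; ring.
have -> : det2 a b * p.2 = b.2 * det2 a p - a.2 * det2 b p by rewrite /det2; ring.
by rewrite ea eb /det2; ring.
Qed.

End StripPoint.

Lemma det2_neq0 (R : realType) (a b : plane R) :
  det2 a b != 0 -> a != 0 /\ b != 0.
Proof.
by move=> h; split; apply: contra_neq h => ->; rewrite /det2 /= ?mul0r ?mulr0 subr0.
Qed.

Lemma det2_combz (R : realType) (a u v : plane R) (m n : int) :
  det2 a (u *~ m + v *~ n) = det2 a u * m%:~R + det2 a v * n%:~R.
Proof. rewrite combz_pair /det2 /=; ring. Qed.

Lemma det2Nl (R : realType) (a b : plane R) : det2 (- a) b = - det2 a b.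
Proof. rewrite /det2 /=; ring. Qed.

Lemma det2Nr (R : realType) (a b : plane R) : det2 a (- b) = - det2 a b.
Proof. rewrite /det2 /=; ring. Qed.

Lemma det2B (R : realType) (a p q : plane R) :
  det2 a (p - q) = det2 a p - det2 a q.
Proof. rewrite /det2 /=; ring. Qed.

Lemma interior_strip_abs (R : realType) (K : set (plane R)) (a p : plane R) :
  a != 0 -> (forall q, K q -> `|det2 a q| <= 1) -> interior K p ->
  `|det2 a p| < 1.
Proof.
move=> a0 Ka ip; rewrite ltr_norml; apply/andP; split; last first.
  by apply: (@interior_strip R K) => // q /Ka; rewrite ler_norml => /andP[].
rewrite -ltrN2 opprK -det2Nl; apply: (@interior_strip R K) => //.
  by rewrite oppr_eq0.
by move=> q /Ka; rewrite det2Nl lerNl ler_norml => /andP[].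
Qed.

Lemma adjacent_ints (m n : int) :
  m - n < 2 -> n - m < 2 -> [\/ m = n, m = n + 1 | n = m + 1].
Proof.
move=> d1 d2; have [e|[e|e]] : m = n \/ m = n + 1 \/ n = m + 1 by lia.
- exact: Or31.
- exact: Or32.
- exact: Or33.
Qed.

Lemma int_abs_lt1 (m : int) : -1 < m -> m < 1 -> m = 0.
Proof. by move=> m1 m2; lia. Qed.

(** In the coordinates given by [det2 a] and [det2 b], the disc lies in the
    hexagon $|x|, |y| \leq 1$, $|x - y| \leq 2 - 2h$.  The lattice through the
    midpoints $(1,h)$, $(h,1)$, $(1-h,h-1)$ of its sides has determinant
    $1 - h^2$, and doubling it gives a lattice tiling by the hexagon. *)
Lemma truncated_admissible (R : realType) (K : set (plane R)) (a b : plane R)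
    (h : R) :
  ccs K -> det2 a b != 0 -> 0 < h < 1 ->
  (forall q, K q -> `|det2 a q| <= 1) -> (forall q, K q -> `|det2 b q| <= 1) ->
  (forall q, K q -> det2 a q - det2 b q <= 2 - 2 * h) ->
  exists L, admissible K L /\ covolume L = (1 - h ^+ 2) / `|det2 a b|.
Proof.
move=> cK ab0 /andP[h0 h1] Ka Kb Kab; have [_ _ _ symK] := cK.
have [a0 b0] := det2_neq0 ab0.
pose u := strip_point a b 1 h; pose v := strip_point a b h 1.
have euv : det2 u v = (1 - h ^+ 2) / det2 a b.
  by rewrite det2_strip_point //; congr (_ / _); ring.
have h2 : 0 < 1 - h ^+ 2 by nra.
have Luv : lattice_basis [set p | exists m n : int, p = u *~ m + v *~ n] u v.
  by split => //; rewrite euv mulf_neq0 ?invr_eq0 // gt_eqF.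
exists [set p | exists m n : int, p = u *~ m + v *~ n]; split; last first.
  by rewrite (covolume_basis Luv) euv normrM normfV (gtr0_norm h2).
split; first by exists u, v.
have iN p : interior K p -> interior K (- p).
  move=> /nbhs_plane[e e0 sK]; apply/nbhs_plane; exists e => // q h3 h4.
  rewrite -[q]opprK; apply: symK; apply: sK.
    by rewrite -normrN /= opprB addrC opprK; move: h3; rewrite /= opprK addrC.
  by rewrite -normrN /= opprB addrC opprK; move: h4; rewrite /= opprK addrC.
have cut p : interior K p -> det2 a p - det2 b p < 2 - 2 * h.
  move=> ip.
  have -> : det2 a p - det2 b p = det2 (a - b) p by rewrite /det2 /=; ring.
  apply: (@interior_strip R K) => // [|q Kq].
    apply: contra_neq ab0 => /eqP; rewrite subr_eq0 => /eqP ->.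
    by rewrite /det2 mulrC subrr.
  by rewrite (_ : det2 _ _ = det2 a q - det2 b q) ?Kab // /det2 /=; ring.
move=> p [m [n ep]] ip.
have := interior_strip_abs a0 Ka ip; have := interior_strip_abs b0 Kb ip.
rewrite !ltr_norml.
have := cut _ (iN _ ip); have := cut _ ip; rewrite !det2Nr.
rewrite ep !det2_combz /u /v !det2_strip_pointl // !det2_strip_pointr //.
set x : R := m%:~R; set y : R := n%:~R => c1 c2 /andP[c3 c4] /andP[c5 c6].
have h1' : 0 < 1 - h by rewrite subr_gt0.
have h1'' : 0 < 1 + h by rewrite addr_gt0.
have d1 : m - n < 2 by rewrite -(ltr_int R) intrB -/x -/y -(ltr_pM2r h1'); lra.
have d2 : n - m < 2 by rewrite -(ltr_int R) intrB -/x -/y -(ltr_pM2r h1'); lra.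
(* The third strip leaves $m - n \in \{-1, 0, 1\}$; each case is excluded by
   the other two, except for the origin. *)
have [e|e|e] := adjacent_ints d1 d2.
- have ey : y = x by rewrite /y -e.
  have m1 : m < 1 by rewrite -(ltr_int R) -/x -(ltr_pM2r h1''); rewrite ey in c5 c6; lra.
  have m2 : -1 < m.
    by rewrite -(ltr_int R) -/x intrN -(ltr_pM2r h1''); rewrite ey in c5 c6; lra.
  by have m0 := int_abs_lt1 m2 m1; rewrite -e m0 !mulr0z addr0.
- have ex : x = y + 1 by rewrite /x e intrD.
  rewrite ex in c3 c4 c5 c6.
  have n1 : n < 0 by rewrite -(ltr_int R) -/y -(ltr_pM2r h1''); lra.
  have n2 : -1 < n by rewrite -(ltr_int R) -/y intrN -(ltr_pM2r h1''); lra.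
  by have := n1; rewrite (int_abs_lt1 n2 (lt_trans n1 ltr01)) ltxx.
- have ey : y = x + 1 by rewrite /y e intrD.
  rewrite ey in c3 c4 c5 c6.
  have m1 : m < 0 by rewrite -(ltr_int R) -/x -(ltr_pM2r h1''); lra.
  have m2 : -1 < m by rewrite -(ltr_int R) -/x intrN -(ltr_pM2r h1''); lra.
  by have := m1; rewrite (int_abs_lt1 m2 (lt_trans m1 ltr01)) ltxx.
Qed.

(** A disc that stayed away from the corner $(1,-1)$ of the parallelogram would
    have an admissible lattice of covolume less than [c0]. *)
Lemma corner_reached (R : realType) (K : set (plane R)) (a b : plane R)
    (c0 h : R) :
  ccs K -> (forall L, admissible K L -> c0 <= covolume L) ->
  0 < h < 1 -> 1 - h ^+ 2 < c0 * `|det2 a b| ->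
  (forall q, K q -> `|det2 a q| <= 1) -> (forall q, K q -> `|det2 b q| <= 1) ->
  exists q, [/\ K q, 1 - 2 * h <= det2 a q & det2 b q <= - (1 - 2 * h)].
Proof.
move=> cK min h01 small Ka Kb.
have ab0 : det2 a b != 0.
  by apply: contraTneq small => ->; rewrite normr0 mulr0 -leNgt; nra.
apply: contrapT => noq.
have Kab q : K q -> det2 a q - det2 b q <= 2 - 2 * h.
  move=> Kq; rewrite leNgt; apply/negP => lt; apply: noq; exists q.
  have := Ka _ Kq; have := Kb _ Kq; rewrite !ler_norml.
  by move=> /andP[? ?] /andP[? ?]; split => //; lra.
have [L [admL cL]] := truncated_admissible cK ab0 h01 Ka Kb Kab.
have := min _ admL; rewrite cL ler_pdivlMr ?normr_gt0 //.
by rewrite leNgt small.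
Qed.

(** The intermediate value on a segment.  The last clause records that the
    point found is a convex combination, so that it inherits every linear lower
    bound common to both ends. *)
Lemma level_point (R : realType) (K : set (plane R)) (b p q : plane R) (d : R) :
  ccs K -> K p -> K q -> det2 b p <= d <= det2 b q ->
  exists w, [/\ K w, det2 b w = d &
    forall a c, c <= det2 a p -> c <= det2 a q -> c <= det2 a w].
Proof.
move=> cK Kp Kq /andP[bp bq].
have [e|ne] := eqVneq (det2 b p) (det2 b q).
  by exists p; split => //; apply: le_anti; rewrite bp e bq.
have lt : 0 < det2 b q - det2 b p.
  by rewrite subr_gt0 lt_neqAle ne (le_trans bp bq).
pose t := (det2 b q - d) / (det2 b q - det2 b p).
have t01 : 0 <= t <= 1.
  apply/andP; split; first by rewrite divr_ge0 ?(ltW lt) // subr_ge0.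
  by rewrite ler_pdivrMr // mul1r; lra.
exists (t * p.1 + (1 - t) * q.1, t * p.2 + (1 - t) * q.2); split.
- exact: convex_comb.
- rewrite (_ : det2 b _ = t * det2 b p + (1 - t) * det2 b q).
    by rewrite /t; field; rewrite gt_eqF.
  by rewrite /det2 /=; ring.
- move=> a c ap aq.
  rewrite (_ : det2 a _ = t * det2 a p + (1 - t) * det2 a q).
    by move: t01 => /andP[t0 t1]; nra.
  by rewrite /det2 /=; ring.
Qed.

(** The disc reaches the four corners up to $2h$.  A point [w] of the smaller
    parallelogram is then reached in two steps: on the segments that join the
    corners of the right and of the left side, take the points at the height of
    [w]; the segment between them passes through [w]. *)
Lemma shrunk_parallelogram_sub (R : realType) (K : set (plane R))
    (a b : plane R) (c0 h : R) :
  ccs K -> (forall L, admissible K L -> c0 <= covolume L) ->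
  0 < h < 1 -> 1 - h ^+ 2 < c0 * `|det2 a b| ->
  (forall q, K q -> `|det2 a q| <= 1) -> (forall q, K q -> `|det2 b q| <= 1) ->
  forall w, `|det2 a w| <= 1 - 2 * h -> `|det2 b w| <= 1 - 2 * h -> K w.
Proof.
move=> cK min h01 small Ka Kb w; have [_ _ _ symK] := cK.
have ab0 : det2 a b != 0.
  by apply: contraTneq small => ->; rewrite normr0 mulr0 -leNgt; nra.
have [p [Kp ap bp]] := corner_reached cK min h01 small Ka Kb.
have small' : 1 - h ^+ 2 < c0 * `|det2 a (- b)| by rewrite det2Nr normrN.
have Kb' q : K q -> `|det2 (- b) q| <= 1 by rewrite det2Nl normrN; exact: Kb.
have [q [Kq aq]] := corner_reached cK min h01 small' Ka Kb'.
rewrite det2Nl lerN2 => bq.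
rewrite !ler_norml => /andP[aw1 aw2] /andP[bw1 bw2].
have bw : det2 b p <= det2 b w <= det2 b q.
  by rewrite (le_trans bp) // (le_trans bw2).
have bw' : det2 b (- q) <= det2 b w <= det2 b (- p).
  by rewrite !det2Nr; lra.
have [w1 [Kw1 bw1' /(_ a _ ap aq) aw1']] := level_point cK Kp Kq bw.
have [w2 [Kw2 bw2' /(_ (- a) (1 - 2 * h))]] :=
  level_point cK (symK _ Kq) (symK _ Kp) bw'.
rewrite !det2Nl !det2Nr !opprK => /(_ aq ap) aw2'.
have aw : det2 a w2 <= det2 a w <= det2 a w1 by lra.
have [w' [Kw' aw' H]] := level_point cK Kw2 Kw1 aw.
rewrite (_ : w = w') //; apply: (strip_point_inj ab0) => //.
apply: le_anti; apply/andP; split; first by apply: H; rewrite ?bw1' ?bw2'.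
by rewrite -lerN2 -!det2Nl; apply: H; rewrite !det2Nl ?bw1' ?bw2'.
Qed.

(** * Area and affine maps *)

(** Bundles [pushforward m f] with its measure structure, which depends on a
    proof that [f] is measurable. *)
Definition image_measure d d' (T : measurableType d) (T' : measurableType d')
    (R : realType) (m : {measure set T -> \bar R}) (f : T -> T')
    (mf : measurable_fun [set: T] f) : {measure set T' -> \bar R} :=
  measure_function_pushforward__canonical__measure_function_Measure m mf.

Lemma lebesgue_measure_affine (R : realType) (k t : R)
    (A : set (measurableTypeR R)) :
  0 < k -> measurable A ->
  lebesgue_measure A =
  (k%:E * lebesgue_measure ((fun x => k * (x - t))%R @^-1` A))%E.
Proof.
move=> k0 mA.
pose g (x : measurableTypeR R) : measurableTypeR R := k * (x - t).
have mg : measurable_fun setT g.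
  by apply: measurable_funM => //; exact: measurable_funB.
transitivity (mscale (NngNum (ltW k0)) (image_measure (@lebesgue_measure R) mg) A) => //.
apply: lebesgue_measure_unique => // _ [[a b] _ <-].
rewrite /= /mscale /= /pushforward /g.
rewrite (_ : _ @^-1` _ = `]a / k + t, b / k + t]%classic); last first.
  apply/seteqP; split => x /=; rewrite !in_itv /=.
    by rewrite -ltrBrDr -lerBlDr ltr_pdivrMr // ler_pdivlMr // mulrC.
  by rewrite -ltrBrDr -lerBlDr ltr_pdivrMr // ler_pdivlMr // mulrC.
rewrite !lebesgue_measure_itv /= !lte_fin ltrD2r ltr_pM2r ?invr_gt0 //.
case: ifPn => _; last by rewrite mule0.
by rewrite -!EFinD -EFinM; congr EFin; field; rewrite gt_eqF.
Qed.

(** The plane as the product of two copies of the Borel line. *)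
Local Notation mplane R := (measurableTypeR R * measurableTypeR R)%type.

(** Both sides are measures in [A] that agree on products of measurable sets. *)
Lemma area_affine (R : realType) (k : R) (t : plane R) (A : set (mplane R)) :
  0 < k -> measurable A ->
  area A =
  ((k ^+ 2)%:E * area [set p | A (k * (p.1 - t.1), k * (p.2 - t.2))%R])%E.
Proof.
move=> k0 mA.
pose g (p : mplane R) : mplane R := (k * (p.1 - t.1), k * (p.2 - t.2)).
have mg : measurable_fun setT g.
  apply: measurable_fun_pair.
    by apply: measurable_funM => //; exact: measurable_funB.
  by apply: measurable_funM => //; exact: measurable_funB.
transitivity (mscale (NngNum (ltW (exprn_gt0 2 k0)))
  (image_measure (((@lebesgue_measure R) \x (@lebesgue_measure R))%E) mg) A) => //.
apply: product_measure_unique => // B C mB mC.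
rewrite /= /mscale /= /pushforward.
rewrite (_ : g @^-1` _ = ((fun x => k * (x - t.1)) @^-1` B) `*`
  ((fun x => k * (x - t.2)) @^-1` C)) //.
have mk c D : measurable D ->
    measurable ((fun x : measurableTypeR R => k * (x - c)) @^-1` D).
  move=> mD; rewrite -[X in measurable X]setTI.
  have : measurable_fun setT (fun x : measurableTypeR R => k * (x - c)).
    by apply: measurable_funM => //; exact: measurable_funB.
  exact.
rewrite (product_measure1E _ _ (mk _ _ mB) (mk _ _ mC)).
rewrite (lebesgue_measure_affine t.1 k0 mB) (lebesgue_measure_affine t.2 k0 mC).
by rewrite expr2 EFinM -!muleA; congr mule; rewrite muleCA.
Qed.

(** The rational boxes inside an open set cover it, and there are countably
    many of them. *)
Lemma open_plane_measurable (R : realType) (U : set (plane R)) :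
  open U -> measurable (U : set (mplane R)).
Proof.
move=> oU.
pose box (q : (rat * rat) * (rat * rat)) : set (mplane R) :=
  [set` `]ratr q.1.1, ratr q.1.2[ ] `*` [set` `]ratr q.2.1, ratr q.2.2[ ].
rewrite (_ : U = \bigcup_(q in [set q | box q `<=` U]) box q).
  rewrite bigcup_mkcond; apply: countable_bigcupT_measurable => // q.
  by case: ifP => // _; apply: measurableX; exact: measurable_itv.
apply/seteqP; split => [p Up|p [q bq]]; last exact: bq.
have /nbhs_plane[e e0 sU] : nbhs p U by exact: open_nbhs_nbhs.
have itv (c : R) : exists a b : rat, [/\ ratr a < c < ratr b,
    c - e < ratr a & ratr b < c + e].
  have [a] : exists a : rat, ratr a \in `]c - e, c[.
    by apply: rat_in_itvoo; lra.
  have [b] : exists b : rat, ratr b \in `]c, c + e[.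
    by apply: rat_in_itvoo; lra.
  rewrite !in_itv /= => /andP[b1 b2] /andP[a1 a2].
  by exists a, b; rewrite a2 b1.
have [a [b [ab ac bc]]] := itv p.1; have [a' [b' [ab' ac' bc']]] := itv p.2.
exists ((a, b), (a', b')); last by split; rewrite /= in_itv.
move=> q /= [] /=; rewrite !in_itv /= => /andP[h1 h2] /andP[h3 h4].
by apply: sU; rewrite ltr_distl; apply/andP; split; lra.
Qed.

Lemma closed_plane_measurable (R : realType) (F : set (plane R)) :
  closed F -> measurable (F : set (mplane R)).
Proof.
move=> cF; rewrite -[F]setCK; apply: measurableC; apply: open_plane_measurable.
exact: closed_openC.
Qed.

(** * Euclidean discs *)

Lemma edisc_sqr (R : realType) (r : R) (p : plane R) :
  0 <= r -> edisc r p <-> p.1 ^+ 2 + p.2 ^+ 2 <= r ^+ 2.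
Proof.
move=> r0; rewrite /edisc /Defs.edist /= !subr0.
have s0 : 0 <= p.1 ^+ 2 + p.2 ^+ 2 by rewrite addr_ge0 ?sqr_ge0.
by rewrite -(@ler_sqr R) ?nnegrE ?sqrtr_ge0 // sqr_sqrtr.
Qed.

Lemma edisc_add (R : realType) (r c : R) (p w : plane R) :
  0 <= c -> 2 * c <= r -> edisc (r - 2 * c) p -> `|w.1| <= c -> `|w.2| <= c ->
  edisc r (p + w).
Proof.
move=> c0 cr; rewrite edisc_sqr ?subr_ge0 // edisc_sqr /=; last by lra.
set N := r - 2 * c => pN w1 w2.
have N0 : 0 <= N by rewrite subr_ge0.
have n1 : `|p.1| <= N by rewrite -ler_sqr ?nnegrE // real_normK ?num_real //; nra.
have n2 : `|p.2| <= N by rewrite -ler_sqr ?nnegrE // real_normK ?num_real //; nra.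
have m1 : p.1 * w.1 <= N * c.
  by rewrite (le_trans (ler_norm _)) // normrM ler_pM.
have m2 : p.2 * w.2 <= N * c.
  by rewrite (le_trans (ler_norm _)) // normrM ler_pM.
have s1 : w.1 ^+ 2 <= c ^+ 2.
  by rewrite -real_normK ?num_real // ler_sqr ?nnegrE.
have s2 : w.2 ^+ 2 <= c ^+ 2.
  by rewrite -real_normK ?num_real // ler_sqr ?nnegrE.
rewrite (_ : r = N + 2 * c); last by rewrite /N; ring.
have -> : (p.1 + w.1) ^+ 2 + (p.2 + w.2) ^+ 2 = p.1 ^+ 2 + p.2 ^+ 2 +
  2 * (p.1 * w.1) + 2 * (p.2 * w.2) + w.1 ^+ 2 + w.2 ^+ 2 by ring.
have -> : (N + 2 * c) ^+ 2 = N ^+ 2 + 4 * (N * c) + 4 * c ^+ 2 by ring.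
have := sqr_ge0 c; lra.
Qed.

Lemma edisc_measurable (R : realType) (r : R) :
  0 <= r -> measurable (edisc r : set (mplane R)).
Proof.
move=> r0.
pose f (p : mplane R) : measurableTypeR R := p.1 ^+ 2 + p.2 ^+ 2.
have mf : measurable_fun setT f.
  by apply: measurable_funD; apply: measurable_funX.
rewrite (_ : edisc r = setT `&` f @^-1` [set` `]-oo, r ^+ 2]]); first exact: mf.
rewrite setTI; apply/seteqP; split => p /=; rewrite in_itv /=.
  by move/(edisc_sqr p r0).
by move=> h; apply/(edisc_sqr p r0).
Qed.

Lemma area_edisc (R : realType) (r : R) :
  0 < r -> area (edisc r) = ((r ^+ 2)%:E * area (edisc 1))%E.
Proof.
move=> r0; have r0' : 0 < r^-1 by rewrite invr_gt0.
rewrite (area_affine 0 r0' (edisc_measurable ler01)) muleA -EFinM -exprMn.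
rewrite divff ?gt_eqF // expr1n mul1e; congr (area _).
apply/seteqP; split => p /=.
  move/(edisc_sqr p (ltW r0)) => h; apply/(edisc_sqr _ ler01) => /=.
  by rewrite !subr0 !exprMn -mulrDr exprVn mulrC ler_pdivrMr ?exprn_gt0 // expr1n mul1r.
move/(edisc_sqr _ ler01) => /=.
rewrite !subr0 !exprMn -mulrDr exprVn mulrC ler_pdivrMr ?exprn_gt0 // expr1n mul1r.
by move=> h; apply/(edisc_sqr p (ltW r0)).
Qed.

Lemma area_square (R : realType) (c : R) :
  0 < c -> area ([set` `[- c, c]] `*` [set` `[- c, c]]) = ((2 * c) ^+ 2)%:E.
Proof.
move=> c0; rewrite /area product_measure1E; try exact: measurable_itv.
rewrite /= lebesgue_measure_itv /= lte_fin (_ : - c < c); last by lra.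
by rewrite -EFinD -EFinM; congr EFin; ring.
Qed.

Lemma area_edisc1 (R : realType) :
  exists2 d : R, 0 < d & area (@edisc R 1) = d%:E.
Proof.
have m1 : measurable (@edisc R 1 : set (mplane R)) by exact: edisc_measurable.
have msq c : measurable ([set` `[- c, c]] `*` [set` `[- c, c]] : set (mplane R)).
  by apply: measurableX; exact: measurable_itv.
have le1 : (area (@edisc R 1) <= (2 ^+ 2)%:E)%E.
  rewrite -[2 ^+ 2](_ : (2 * 1) ^+ 2 = _); last by rewrite mulr1.
  rewrite -area_square //; apply: le_measure; rewrite ?inE //.
  move=> p /(edisc_sqr p ler01) h; split => /=; rewrite in_itv /= -ler_norml.
    by rewrite -(@ler_sqr R) ?nnegrE // real_normK ?num_real //; nra.
  by rewrite -(@ler_sqr R) ?nnegrE // real_normK ?num_real //; nra.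
have ge1 : (((2 * (1 / 2)) ^+ 2)%:E <= area (@edisc R 1))%E.
  rewrite -area_square //; apply: le_measure; rewrite ?inE //.
  move=> p [] /=; rewrite !in_itv /= => h1 h2; apply/(edisc_sqr p ler01).
  by nra.
exists (fine (area (@edisc R 1))).
  rewrite fine_gt0 //; apply/andP; split.
    by apply: lt_le_trans ge1; rewrite lte_fin; lra.
  by apply: le_lt_trans le1 _; rewrite ltry.
rewrite fineK // fin_num_abs gee0_abs ?measure_ge0 //.
by apply: le_lt_trans le1 _; rewrite ltry.
Qed.

(** * The packing by the translates of a parallelogram *)

Definition cell (R : realType) (a b : plane R) (m : R) (v : plane R) :
    set (plane R) :=
  [set p | `|det2 a (p - v)| <= m /\ `|det2 b (p - v)| <= m].

(** The parallelogram [cell a b 1 0] is $[-1,1]^2$ in the coordinates [det2 a],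
    [det2 b]: it tiles by the points with even integer coordinates. *)
Definition tile_vertex (R : realType) (a b : plane R) (x : int * int) :=
  strip_point a b (2 * x.1%:~R) (2 * x.2%:~R).

Definition tile_packing (R : realType) (K : set (plane R)) (a b : plane R) :
    set (set (plane R)) :=
  [set [set p | K (p - tile_vertex a b x)] | x in [set: int * int]].

Section Tiling.
Variables (R : realType) (K : set (plane R)) (a b : plane R).
Hypothesis ab0 : det2 a b != 0.
Hypothesis Ka : forall q, K q -> `|det2 a q| <= 1.
Hypothesis Kb : forall q, K q -> `|det2 b q| <= 1.

Let lam := tile_vertex a b.

Lemma cell_measurable m v : measurable (cell a b m v : set (mplane R)).
Proof.
have mdet c : measurable_fun setT
    (fun p : mplane R => (det2 c (p - v) : measurableTypeR R)).
  apply: measurable_funB.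
    by apply: measurable_funM => //; exact: measurable_funB.
  by apply: measurable_funM => //; exact: measurable_funB.
rewrite (_ : cell a b m v =
    (setT `&` (fun p : mplane R => det2 a (p - v)) @^-1` [set` `[- m, m]]) `&`
    (setT `&` (fun p : mplane R => det2 b (p - v)) @^-1` [set` `[- m, m]])).
  by apply: measurableI; apply: mdet => //; exact: measurable_itv.
rewrite !setTI; apply/seteqP; split => p; rewrite /cell /= !in_itv /= -!ler_norml.
  by [].
by [].
Qed.

Lemma area_cell m v :
  0 < m -> area (cell a b m v) = ((m ^+ 2)%:E * area (cell a b 1%R 0%R))%E.
Proof.
move=> m0; have m0' : 0 < m^-1 by rewrite invr_gt0.
rewrite (area_affine v m0' (cell_measurable 1 0)) muleA -EFinM -exprMn.
rewrite divff ?gt_eqF // expr1n mul1e; congr (area _).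
have e c (p : plane R) : `|det2 c ((m^-1 * (p.1 - v.1), m^-1 * (p.2 - v.2)) - 0)|
    = `|det2 c (p - v)| / m.
  rewrite -[X in _ / X](gtr0_norm m0) -normfV -normrM; congr `|_|.
  by rewrite subr0 /det2 /=; ring.
apply/seteqP; split => p; rewrite /cell /= !e !ler_pdivrMr // mul1r; exact.
Qed.

(** Distinct vertices differ by at least two in one of the coordinates, which
    gives both the packing property and the disjointness of smaller cells. *)
Lemma vertex_close x y :
  `|det2 a (lam x - lam y)| < 2 -> `|det2 b (lam x - lam y)| < 2 -> x = y.
Proof.
rewrite !det2B /lam /tile_vertex !det2_strip_pointl // !det2_strip_pointr //.
have close (m n : int) : `|2 * m%:~R - 2 * n%:~R : R| < 2 -> m = n.
  rewrite ltr_norml => /andP[h1 h2].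
  have : m - n = 0.
    apply: int_abs_lt1; rewrite -(ltr_int R) ?intrN intrB; lra.
  by move/eqP; rewrite subr_eq0 => /eqP.
by case: x y => [x1 x2] [y1 y2] /= /close -> /close ->.
Qed.

Lemma tile_exists (p : plane R) : exists x, cell a b 1 (lam x) p.
Proof.
have round (t : R) : exists n : int, `|t - 2 * n%:~R| <= 1.
  exists (Num.floor ((t + 1) / 2)); have := floor_itv ((t + 1) / 2).
  by rewrite intrD ler_norml; lra.
have [n nP] := round (det2 a p); have [m mP] := round (det2 b p).
exists (n, m); rewrite /cell /= !det2B /lam /tile_vertex.
by rewrite det2_strip_pointl // det2_strip_pointr.
Qed.

(** The disc lies in the cell, and the cells tile. *)
Lemma tile_packingP : packing K (tile_packing K a b).
Proof.
split=> [_ [x _ <-]|].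
  exists (fun p => p + lam x); split => [p q|].
    by rewrite /Defs.edist /=; congr Num.sqrt; ring.
  apply/seteqP; split => [p Kp|_ [p Kp <-]] /=; last first.
    by rewrite (_ : _ + _ - _ = p) //; exact: addrK.
  by exists (p - lam x); [exact: Kp|exact: subrK].
have iK x p : interior [set p | K (p - lam x)] p -> interior K (p - lam x).
  move=> /nbhs_plane[e e0 sK]; apply/nbhs_plane; exists e => // q h1 h2.
  rewrite -[q](addrK (lam x)); apply: sK.
    by move: h1; rewrite /= opprB addrA.
  by move: h2; rewrite /= opprB addrA.
have [a0 b0] := det2_neq0 ab0.
move=> _ _ [x _ <-] [y _ <-] [p [/iK ix /iK iy]].
suff -> : x = y by [].
have close c : c != 0 -> (forall q, K q -> `|det2 c q| <= 1) ->
    `|det2 c (lam x - lam y)| < 2.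
  move=> c0 Kc.
  have -> : lam x - lam y = (p - lam y) - (p - lam x).
    by rewrite opprB [RHS]addrC addrA subrK.
  rewrite det2B; apply: le_lt_trans (ler_normB _ _) _.
  by have := interior_strip_abs c0 Kc ix; have := interior_strip_abs c0 Kc iy; lra.
by apply: vertex_close; exact: close.
Qed.

End Tiling.

Section Density.
Variables (R : realType) (K : set (plane R)) (a b : plane R) (m : R).
Hypothesis ab0 : det2 a b != 0.
Hypothesis cK : ccs K.
Hypothesis Ka : forall q, K q -> `|det2 a q| <= 1.
Hypothesis Kb : forall q, K q -> `|det2 b q| <= 1.
Hypothesis m01 : 0 < m < 1.
Hypothesis Km : cell a b m 0 `<=` K.

Let lam := tile_vertex a b.
Let U := \bigcup_(A in tile_packing K a b) A.

Lemma tile_union_measurable : measurable (U : set (mplane R)).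
Proof.
rewrite /U /tile_packing bigcup_image.
apply: countable_bigcupT_measurable => // x.
have mK : measurable (K : set (mplane R)).
  apply: closed_plane_measurable; apply: compact_closed; first exact: norm_hausdorff.
  by case: cK.
pose g (p : mplane R) : mplane R := (p.1 - (lam x).1, p.2 - (lam x).2).
have mg : measurable_fun setT g.
  by apply: measurable_fun_pair; exact: measurable_funB.
by rewrite -[X in measurable X]setTI; exact: mg.
Qed.

(** A bound for the coordinates of a vector on which both forms are at most two
    in absolute value. *)
Let c := 2 * (`|a.1| + `|b.1| + `|a.2| + `|b.2|) / `|det2 a b|.

Lemma cell_diameter x p q : cell a b 1 x p -> cell a b m x q ->
  `|(q - p).1| <= c /\ `|(q - p).2| <= c.
Proof.
move=> [pa pb] [qa qb]; have [m0 m1] := andP m01.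
have D0 : 0 < `|det2 a b| by rewrite normr_gt0.
have close e : `|det2 e (p - x)| <= 1 -> `|det2 e (q - x)| <= m ->
    `|det2 e (q - p)| <= 2.
  move=> h1 h2; rewrite (_ : q - p = (q - x) - (p - x)).
    by rewrite det2B (le_trans (ler_normB _ _)) //; lra.
  by rewrite opprB addrA subrK.
have ca := close _ pa qa; have cb := close _ pb qb.
set w := q - p in ca cb *.
have e1 : det2 a b * w.1 = det2 a w * b.1 - det2 b w * a.1 by rewrite /det2; ring.
have e2 : det2 a b * w.2 = det2 a w * b.2 - det2 b w * a.2 by rewrite /det2; ring.
have bound (s t : R) : `|det2 a w * s - det2 b w * t| <= 2 * (`|s| + `|t|).
  rewrite (le_trans (ler_normB _ _)) // !normrM mulrDr.
  by rewrite lerD // ler_wpM2r.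
have na1 := normr_ge0 a.1; have na2 := normr_ge0 a.2.
have nb1 := normr_ge0 b.1; have nb2 := normr_ge0 b.2.
split; rewrite /c ler_pdivlMr // mulrC -normrM.
  by rewrite e1 (le_trans (bound _ _)) //; lra.
by rewrite e2 (le_trans (bound _ _)) //; lra.
Qed.

(* The cells are listed along a numbering of the pairs of integers; a number
   that is not a code stands for the pair $(0,0)$, and [S r] retains codes
   only. *)
Let F n : set (mplane R) := cell a b m (lam (odflt (0, 0) (unpickle n))).
Let G n : set (mplane R) := cell a b 1 (lam (odflt (0, 0) (unpickle n))).
Let S r : set nat := [set n | exists x, n = pickle x /\ cell a b m (lam x) `<=` edisc r].

Lemma disc_sub_cells r : 0 <= c -> 2 * c <= r ->
  edisc (r - 2 * c) `<=` \bigcup_(n in S r) G n.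
Proof.
move=> c0 cr p pr; have [x xp] := tile_exists ab0 p.
exists (pickle x); last by rewrite /G pickleK.
exists x; split => // q xq; have [h1 h2] := cell_diameter xp xq.
by rewrite -(subrK p q) addrC; exact: (edisc_add c0 cr pr).
Qed.

Lemma cells_sub_tiles r :
  \bigcup_(n in S r) F n `<=` U `&` edisc r.
Proof.
move=> p [_ [x [-> xr]]]; rewrite /F pickleK /= => xp; split; last exact: xr.
exists [set q | K (q - lam x)]; first by exists x.
by apply: Km; move: xp; rewrite /cell /= subr0.
Qed.

Lemma cells_disjoint r : trivIset (S r) F.
Proof.
move=> _ _ [x [-> _]] [y [-> _]] [p]; rewrite /F !pickleK /= => -[[xa xb] [ya yb]].
congr pickle; have [m0 m1] := andP m01.
have close e : `|det2 e (p - lam x)| <= m -> `|det2 e (p - lam y)| <= m ->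
    `|det2 e (lam x - lam y)| < 2.
  move=> h1 h2; have -> : lam x - lam y = (p - lam y) - (p - lam x).
    by rewrite opprB [RHS]addrC addrA subrK.
  by rewrite det2B; apply: le_lt_trans (ler_normB _ _) _; lra.
by apply: (vertex_close ab0); exact: close.
Qed.

(** The large cells that meet the smaller disc cover it, and the small cells
    inside them are disjoint and lie in the larger disc; cell by cell, the areas
    are in the ratio $m^2$. *)
Lemma area_tiles_ge r : 0 <= c -> 2 * c <= r ->
  ((m ^+ 2)%:E * area (edisc (r - 2 * c)) <= area (U `&` edisc r))%E.
Proof.
move=> c0 cr; have [m0 m1] := andP m01.
have r0 : 0 <= r by apply: le_trans cr; rewrite mulr_ge0.
have mF n : measurable (F n) by exact: cell_measurable.
have mG n : measurable (G n) by exact: cell_measurable.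
apply: (@le_trans _ _ (area (\bigcup_(n in S r) F n))); last first.
  apply: le_measure; rewrite ?inE.
  - by apply: bigcup_measurable => n _; exact: mF.
  - by apply: measurableI; [exact: tile_union_measurable|exact: edisc_measurable].
  - exact: cells_sub_tiles.
rewrite /area measure_bigcup //; last exact: cells_disjoint.
have FG n : area (F n) = ((m ^+ 2)%:E * area (G n))%E.
  rewrite [in RHS]/G [in RHS](area_cell _ _ _ ltr01) expr1n mul1e.
  exact: area_cell.
rewrite (eq_eseriesr (fun n _ => FG n)).
rewrite nneseriesZl; last by move=> n _; exact: measure_ge0.
apply: lee_wpmul2l; first by rewrite lee_fin sqr_ge0.
apply: (@le_trans _ _ (area (\bigcup_(n in S r) G n))).
  apply: le_measure; rewrite ?inE.
  - by apply: edisc_measurable; rewrite subr_ge0.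
  - by apply: bigcup_measurable => n _; exact: mG.
  - exact: disc_sub_cells.
rewrite /area bigcup_mkcond [leRHS]eseries_mkcond.
pose GS i : set (mplane R) := if i \in S r then G i else set0.
have mGS i : measurable (GS i) by rewrite /GS; case: ifP => // _; exact: mG.
apply: le_trans (measure_sigma_subadditive _ mGS _ (@subset_refl _ _)) _.
  exact: bigcupT_measurable.
apply: lee_nneseries => [n _ _|n _]; first exact: measure_ge0.
by rewrite /GS; case: ifP => // _; rewrite measure0.
Qed.

(** The loss at the boundary of the disc of radius [r] is of relative order
    $c/r$. *)
Lemma packing_density_ge (d : R) : d < m ^+ 2 -> (d%:E <= packing_density K)%E.
Proof.
move=> dm; have [m0 m1] := andP m01.
apply: (@le_trans _ _ (density (tile_packing K a b))); last first.
  apply: ereal_sup_ubound; exists (tile_packing K a b) => //.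
  exact: tile_packingP.
apply: le_ereal_inf_tmp => _ [V [M [Mreal MV]] <-].
have c0 : 0 <= c by rewrite divr_ge0 // mulr_ge0 // !addr_ge0.
have q0 : 0 <= 4 * c / (m ^+ 2 - d).
  by rewrite divr_ge0 ?mulr_ge0 // subr_ge0 ltW.
(* The last summand makes the relative loss, at most $4c/r$, smaller than the
   gap $m^2 - d$; the others put [r] beyond [M] and $2c$. *)
pose r := `|M| + 2 * c + 1 + 4 * c / (m ^+ 2 - d).
have M0 := ler_norm M; have M1 := normr_ge0 M.
have r0 : 0 < r by rewrite /r; lra.
have cr : 0 < r - 2 * c by rewrite /r; lra.
have Vr : V r by apply: MV; rewrite /r; lra.
apply: (@le_trans _ _ (area (U `&` edisc r) / area (edisc r))%E); last first.
  by apply: ereal_sup_ubound; exists r.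
have [D D0 eD] := area_edisc1 R.
have cr' : 2 * c <= r by rewrite -subr_ge0 ltW.
have := area_tiles_ge c0 cr'.
rewrite (area_edisc cr) (area_edisc r0) eD -!EFinM => H.
have rD : 0 < r ^+ 2 * D by rewrite mulr_gt0 ?exprn_gt0.
rewrite inver gt_eqF // -[d](mulfK (lt0r_neq0 rD)) EFinM.
apply: lee_wpmul2r; first by rewrite lee_fin invr_ge0 ltW.
apply: le_trans H; rewrite lee_fin [leLHS]mulrA [leRHS]mulrA (ler_pM2r D0).
have main : 4 * c <= (m ^+ 2 - d) * r.
  rewrite [leRHS]mulrC -ler_pdivrMr ?subr_gt0 // /r; lra.
have m2 : m ^+ 2 <= 1 by rewrite expr_le1 // ltW.
have m2' : m ^+ 2 * c <= c by rewrite ler_piMl.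
have e : m ^+ 2 * (r - 2 * c) ^+ 2 - d * r ^+ 2 =
  r * ((m ^+ 2 - d) * r - 4 * (m ^+ 2 * c)) + 4 * m ^+ 2 * c ^+ 2 by ring.
have h1 : 0 <= r * ((m ^+ 2 - d) * r - 4 * (m ^+ 2 * c)).
  by apply: mulr_ge0; [exact: ltW|lra].
have h2 : 0 <= 4 * m ^+ 2 * c ^+ 2.
  by apply: mulr_ge0; [apply: mulr_ge0 => //|]; exact: sqr_ge0.
by rewrite -subr_ge0 e addr_ge0.
Qed.

End Density.

(** * The quadratic form of a point of the upper half-plane *)

(** The polarization of $|p_1 - z p_2|^2$.  Up to the factor $-1/y$ it is
    [det2 (Xact z p) q], so that [p] is conjugate to the direction of the side
    of the hexagon at [p]. *)
Definition star_form (R : realType) (z p q : plane R) : R :=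
  p.1 * q.1 - z.1 * (p.1 * q.2 + p.2 * q.1)
  + (z.1 ^+ 2 + z.2 ^+ 2) * (p.2 * q.2).

(** Represents the linear form with value one on the side of the hexagon at
    [p]: [det2 (side_normal z p) q] is [star_form z p q / star_form z p p]. *)
Definition side_normal (R : realType) (z p : plane R) : plane R :=
  (((z.1 ^+ 2 + z.2 ^+ 2) * p.2 - z.1 * p.1) / star_form z p p,
   (z.1 * p.2 - p.1) / star_form z p p).

Section StarForm.
Variables (R : realType) (z : plane R).
Hypothesis y0 : 0 < z.2.

Lemma det2_Xact p q : det2 (Xact z p) q = - (star_form z p q / z.2).
Proof. by rewrite /det2 /star_form /=; field; rewrite gt_eqF. Qed.

Lemma star_form_gt0 p : p != 0 -> 0 < star_form z p p.
Proof.
move=> p0.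
have -> : star_form z p p = (p.1 - z.1 * p.2) ^+ 2 + (z.2 * p.2) ^+ 2.
  by rewrite /star_form; ring.
rewrite lt_neqAle addr_ge0 ?sqr_ge0 // andbT eq_sym paddr_eq0 ?sqr_ge0 //.
rewrite !sqrf_eq0 mulf_eq0 (gt_eqF y0) /=.
apply: contra_neqN p0; case: p => p1 p2 /= /andP[/eqP e1 /eqP e2].
by move: e1; rewrite e2 mulr0 subr0 => ->.
Qed.

Lemma det2_side_normal p q :
  det2 (side_normal z p) q = star_form z p q / star_form z p p.
Proof. by rewrite /det2 /side_normal /star_form /=; ring. Qed.

Lemma det2_side_normals p q :
  det2 (side_normal z p) (side_normal z q) =
  z.2 ^+ 2 * det2 p q / (star_form z p p * star_form z q q).
Proof.
rewrite /side_normal /det2 /= invfM; set u := (star_form z p p)^-1.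
by set v := (star_form z q q)^-1; ring.
Qed.

(** The support line leaves [K] on the same side as the origin, which is the
    side where the form is at most its value at [p]; symmetry gives the opposite
    bound. *)
Lemma support_strip (K : set (plane R)) (p : plane R) : p != 0 ->
  (forall q, K q -> K (- q)) -> support_line K p (line p (Xact z p)) ->
  forall q, K q -> `|det2 (side_normal z p) q| <= 1.
Proof.
move=> p0 symK [Kp [v [v0 elv vK]]].
have B0 := star_form_gt0 p0.
have [s es] : exists s, Xact z p = s *: v.
  have : line p (Xact z p) (p + Xact z p) by exists 1 => //; rewrite scale1r.
  by rewrite elv => -[s _ /addrI <-]; exists s.
have detE q : star_form z p q = star_form z p p - z.2 * s * det2 v (q - p).
  have : det2 (Xact z p) (q - p) = s * det2 v (q - p).
    by rewrite es /det2 /=; rewrite /GRing.scale /=; ring.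
  rewrite det2B !det2_Xact -mulrA => <-; field; by rewrite gt_eqF.
(* The direction [v] and [Xact z p] are proportional; the sign of the factor is
   found by looking at the point $-p$ of [K]. *)
have s0 : 0 <= s.
  have := detE (- p); have := vK _ (symK _ Kp).
  have -> : star_form z p (- p) = - star_form z p p by rewrite /star_form /=; ring.
  move=> h e; rewrite leNgt; apply/negP => sneg.
  have : z.2 * s * det2 v (- p - p) <= 0 by rewrite mulr_le0_ge0 // pmulr_rle0 // ltW.
  by rewrite (_ : _ * _ = 2 * star_form z p p); [lra|move: e; lra].
have le q : K q -> star_form z p q <= star_form z p p.
  by move=> Kq; rewrite (detE q) gerBl mulr_ge0 ?vK // mulr_ge0 // ltW.
move=> q Kq; rewrite det2_side_normal normrM normfV (gtr0_norm B0).
rewrite ler_pdivrMr // mul1r ler_norml le // andbT lerNl.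
have := le _ (symK _ Kq).
by rewrite (_ : star_form z p (- q) = - star_form z p q) // /star_form /=; ring.
Qed.

End StarForm.

(** * The smoothed octagon *)

(** The inequality $\ln x \leq x - 1$ at $x = 1/\sqrt 2$, doubled. *)
Lemma ln2_ge (R : realType) : 2 - Num.sqrt 2 <= ln 2 :> R.
Proof.
have s0 : 0 < Num.sqrt 2 :> R by rewrite sqrtr_gt0.
have s2 : Num.sqrt 2 ^+ 2 = 2 :> R by rewrite sqr_sqrtr.
have e : ln 2 = 2 * ln (Num.sqrt 2) :> R.
  by rewrite -{1}s2 expr2 lnM ?posrE //; ring.
have i0 : 0 < (Num.sqrt 2 : R)^-1 by rewrite invr_gt0.
have i2 : (Num.sqrt 2 : R)^-1 = Num.sqrt 2 / 2.
  by rewrite -{3}s2; field; rewrite gt_eqF.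
have H : - ln (Num.sqrt 2) <= (Num.sqrt 2)^-1 - 1 :> R.
  rewrite -lnV ?posrE //; have := @le_ln1Dx R ((Num.sqrt 2)^-1 - 1).
  by rewrite addrCA subrr addr0; apply; lra.
rewrite e; lra.
Qed.

Lemma delta_oct_lt (R : realType) : delta_oct R < 97 / 100.
Proof.
have s0 : 0 < Num.sqrt 2 :> R by rewrite sqrtr_gt0.
have s2 : Num.sqrt 2 ^+ 2 = 2 :> R by rewrite sqr_sqrtr.
have s1 : 1412 / 1000 < Num.sqrt 2 :> R by nra.
have e8 : Num.sqrt 8 = 2 * Num.sqrt 2 :> R.
  have -> : 8 = 2 ^+ 2 * 2 :> R by ring.
  by rewrite sqrtrM ?exprn_ge0 // sqrtr_sqr ger0_norm.
have e32 : Num.sqrt 32 = 4 * Num.sqrt 2 :> R.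
  have -> : 32 = 4 ^+ 2 * 2 :> R by ring.
  by rewrite sqrtrM ?exprn_ge0 // sqrtr_sqr ger0_norm.
rewrite /delta_oct e8 e32 ltr_pdivrMr; last lra.
have := ln2_ge R; lra.
Qed.

(** * The compact part of the star domain *)

(** By Lagrange's identity [star_form z p p * star_form z q q] exceeds
    $y^2 (\det(p,q))^2 = 3y^2/4$ by the square of [star_form z p q], so the last
    hypothesis says that this square is relatively less than $h^2$, with
    $h = 1/200$. *)
Lemma dense_of_thin_hexagon (R : realType) (K : set (plane R)) (z p q : plane R) :
  ccs K -> circle_representation K -> 0 < z.2 ->
  support_line K p (line p (Xact z p)) -> support_line K q (line q (Xact z q)) ->
  det2 p q = Num.sqrt 3 / 2 ->
  (1 - (1 / 200) ^+ 2) * (star_form z p p * star_form z q q) < 3 / 4 * z.2 ^+ 2 ->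
  ((delta_oct R)%:E < packing_density K)%E.
Proof.
move=> cK circ y0 supp supq epq small; have [_ _ _ symK] := cK.
have s0 : 0 < Num.sqrt 3 :> R by rewrite sqrtr_gt0.
have s2 : Num.sqrt 3 ^+ 2 = 3 :> R by rewrite sqr_sqrtr.
have [p0 q0] : p != 0 /\ q != 0 by apply: det2_neq0; rewrite epq gt_eqF // divr_gt0.
have Bp := star_form_gt0 y0 p0; have Bq := star_form_gt0 y0 q0.
set a := side_normal z p; set b := side_normal z q.
have Ka := support_strip y0 p0 symK supp; have Kb := support_strip y0 q0 symK supq.
have eab : Num.sqrt 3 / 2 * `|det2 a b| =
    3 / 4 * z.2 ^+ 2 / (star_form z p p * star_form z q q).
  rewrite /a /b det2_side_normals epq gtr0_norm; last first.
    by rewrite divr_gt0 ?mulr_gt0 ?exprn_gt0 ?divr_gt0.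
  have -> : 3 / 4 = (Num.sqrt 3 / 2) ^+ 2 :> R by rewrite expr_div_n s2; field.
  by ring.
have ab0 : det2 a b != 0.
  rewrite /a /b det2_side_normals epq gt_eqF //.
  by rewrite divr_gt0 ?mulr_gt0 ?exprn_gt0 ?divr_gt0.
have thin : 1 - (1 / 200) ^+ 2 < Num.sqrt 3 / 2 * `|det2 a b|.
  by rewrite eab ltr_pdivlMr // mulr_gt0.
have fill := shrunk_parallelogram_sub cK (critical_covolume cK circ) _ thin Ka Kb.
have h01 : 0 < (1 / 200 : R) < 1 by lra.
apply: (@lt_le_trans _ _ (98 / 100)%:E).
  by rewrite lte_fin; have := delta_oct_lt R; lra.
apply: (@packing_density_ge R K a b (1 - 2 * (1 / 200))) => //; try lra.
by move=> w [aw bw]; apply: (fill h01); [move: aw|move: bw]; rewrite subr0.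
Qed.

(** The three quantities bounded below by [e] are the values $r$, $t$, $s$ of
    the form at consecutive points [estar j].  The upper bound on the third
    excludes a neighbourhood of infinity. *)
Definition star_core (R : realType) (e : R) : set (plane R) :=
  [set z | [/\ 0 <= z.2,
    e <= 1 / 2 - z.1 * (Num.sqrt 3 / 2), e <= 1 / 2 + z.1 * (Num.sqrt 3 / 2),
    e <= (3 * (z.1 ^+ 2 + z.2 ^+ 2) - 1) / 4 &
    (3 * (z.1 ^+ 2 + z.2 ^+ 2) - 1) / 4 <= e^-1]].

Lemma star_core_compact (R : realType) (e : R) : 0 < e -> compact (star_core e).
Proof.
move=> e0.
have s0 : 0 < Num.sqrt 3 :> R by rewrite sqrtr_gt0.
have s2 : Num.sqrt 3 ^+ 2 = 3 :> R by rewrite sqr_sqrtr.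
have s1 : 1 < Num.sqrt 3 :> R by nra.
have i0 : 0 < e^-1 by rewrite invr_gt0.
pose box : set (plane R) := [set` `[- 1, 1]] `*` [set` `[0, 4 * e^-1 + 1]].
have cbox : compact box by apply: compact_setX; exact: segment_compact.
apply: subclosed_compact cbox _; last first.
  move=> z [y0 r0 t0 _ s]; split => /=; rewrite in_itv /=.
    by apply/andP; split; nra.
  rewrite y0 /=; nra.
have cx : continuous (fun z : plane R => z.1 : R) by move=> z; exact: cvg_fst.
have cy : continuous (fun z : plane R => z.2 : R) by move=> z; exact: cvg_snd.
have cl (f : plane R -> R) (k : R) : continuous f -> closed [set z | k <= f z].
  by move/continuous_closedP => /(_ _ (@closed_ge R k)).
have cr : continuous (fun z : plane R => 1 / 2 - z.1 * (Num.sqrt 3 / 2) : R).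
  by move=> z; apply: cvgB; [exact: cvg_cst|apply: cvgMl; exact: cx].
have ct : continuous (fun z : plane R => 1 / 2 + z.1 * (Num.sqrt 3 / 2) : R).
  by move=> z; apply: cvgD; [exact: cvg_cst|apply: cvgMl; exact: cx].
have cn : continuous (fun z : plane R => (3 * (z.1 ^+ 2 + z.2 ^+ 2) - 1) / 4 : R).
  move=> z; apply: cvgMl; apply: cvgB; last exact: cvg_cst.
  apply: cvgMr; apply: cvgD; apply: cvgM; [exact: cx|exact: cx|exact: cy|exact: cy].
have cn' : continuous (fun z : plane R => - ((3 * (z.1 ^+ 2 + z.2 ^+ 2) - 1) / 4) : R).
  by move=> z; apply: cvgN; exact: cn.
rewrite (_ : star_core e = [set z | 0 <= z.2] `&`
  [set z | e <= 1 / 2 - z.1 * (Num.sqrt 3 / 2)] `&`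
  [set z | e <= 1 / 2 + z.1 * (Num.sqrt 3 / 2)] `&`
  [set z | e <= (3 * (z.1 ^+ 2 + z.2 ^+ 2) - 1) / 4] `&`
  [set z | - e^-1 <= - ((3 * (z.1 ^+ 2 + z.2 ^+ 2) - 1) / 4)]).
  by do 4?[apply: closedI; last exact: cl]; exact: cl.
apply/seteqP; split => z.
  by move=> [h1 h2 h3 h4 h5]; do 4?split => //; rewrite /= lerN2.
by move=> [[[[h1 h2] h3] h4]]; rewrite /= lerN2; split.
Qed.

Section StarCore.
Variables (R : realType) (z : plane R).
Let r := 1 / 2 - z.1 * (Num.sqrt 3 / 2).
Let t := 1 / 2 + z.1 * (Num.sqrt 3 / 2).
Let s := (3 * (z.1 ^+ 2 + z.2 ^+ 2) - 1) / 4.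

(** The determinant of the form on the lattice of the points [estar j]. *)
Lemma star_area : 3 / 4 * z.2 ^+ 2 = r * s + r * t + s * t.
Proof.
have s2 : Num.sqrt 3 ^+ 2 = 3 :> R by rewrite sqr_sqrtr.
have : (z.1 * Num.sqrt 3) ^+ 2 = 3 * z.1 ^+ 2 by rewrite exprMn s2 mulrC.
by rewrite /r /s /t; set w := z.1 * Num.sqrt 3; rewrite !mulrA -/w; lra.
Qed.

Lemma star_domainP : 0 < z.2 -> 0 < r -> 0 < t -> 0 < s -> star_domain R z.
Proof.
have s0 : 0 < Num.sqrt 3 :> R by rewrite sqrtr_gt0.
move=> y0 r0 t0 s0'; split => //.
- by rewrite ltrNl ltr_pdivlMr //; move: t0; rewrite /t; lra.
- by rewrite ltr_pdivlMr //; move: r0; rewrite /r; lra.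
- by move: s0'; rewrite /s; lra.
Qed.

Lemma star_domain_gt0 :
  star_domain R z -> [/\ 0 < z.2, 0 < r, 0 < t & 0 < s].
Proof.
have s0 : 0 < Num.sqrt 3 :> R by rewrite sqrtr_gt0.
move=> [y0]; rewrite ltrNl !ltr_pdivlMr // => x1 x2 n; split=> //.
- by rewrite /r; lra.
- by rewrite /t; lra.
- by rewrite /s; lra.
Qed.

Lemma star_core_sub (e : R) : 0 < e -> star_core e z -> star_domain R z.
Proof.
move=> e0 [y0 r0 t0 s0 _].
have r0' : 0 < r := lt_le_trans e0 r0.
have t0' : 0 < t := lt_le_trans e0 t0.
have s0' : 0 < s := lt_le_trans e0 s0.
apply: star_domainP => //; rewrite lt_neqAle y0 andbT eq_sym.
have : 3 / 4 * z.2 ^+ 2 != 0.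
  rewrite star_area gt_eqF //.
  exact: addr_gt0 (addr_gt0 (mulr_gt0 r0' s0') (mulr_gt0 r0' t0')) (mulr_gt0 s0' t0').
by apply: contra_neq => ->; rewrite expr0n mulr0.
Qed.

Lemma star_form_estar :
  [/\ star_form z (1, 0) (1, 0) = r + t,
      star_form z (1 / 2, Num.sqrt 3 / 2) (1 / 2, Num.sqrt 3 / 2) = r + s,
      star_form z (- (1 / 2), Num.sqrt 3 / 2) (- (1 / 2), Num.sqrt 3 / 2) = s + t &
      star_form z (- 1, 0) (- 1, 0) = r + t].
Proof.
have s2 : Num.sqrt 3 * Num.sqrt 3 = 3 :> R by rewrite -expr2 sqr_sqrtr.
have e : Num.sqrt 3 / 2 * (Num.sqrt 3 / 2) = 3 / 4 :> R.
  by rewrite mulrACA s2; field.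
by rewrite /star_form /= e; split; rewrite /r /s /t; field.
Qed.

End StarCore.

Theorem theorem2p3p15 (R : realType) :
  exists hss : set (plane R),
    [/\ compact hss,
        hss `<=` star_domain R
      & forall z : plane R, (star_domain R `\` hss) z ->
        forall K : set (plane R),
          balanced K -> circle_representation K -> has_critical_hexagon K z ->
          ((delta_oct R)%:E < packing_density K)%E].
Proof.
have e0 : 0 < ((1 / 200) ^+ 2 : R) by lra.
exists (star_core ((1 / 200) ^+ 2)); split.
- exact: star_core_compact.
- by move=> z; exact: star_core_sub.
move=> z [/star_domain_gt0[y0]]; have := star_area z; have := star_form_estar z.
set r := 1 / 2 - _; set t := 1 / 2 + _.
set s := (3 * (z.1 ^+ 2 + z.2 ^+ 2) - 1) / 4.
move=> [B0 B1 B2 B3] area_eq r0 t0 s0 ncore K [cK _ _ _] circ hex.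
have tE : t = 1 - r by rewrite /r /t; lra.
have rE : r = 1 - t by lra.
have h0 := hex (@Ordinal 6 0 isT); rewrite /hexagon_side estar0 in h0.
have h1 := hex (@Ordinal 6 1 isT); rewrite /hexagon_side estar1 in h1.
have h2 := hex (@Ordinal 6 2 isT); rewrite /hexagon_side estar2 in h2.
have h3 := hex (@Ordinal 6 3 isT); rewrite /hexagon_side estar3 in h3.
set e : R := (1 / 200) ^+ 2 in e0 ncore.
have {}ncore : ~ [/\ e <= r, e <= t, e <= s & s <= e^-1].
  by move=> [er et es es']; apply: ncore; split;
    [exact: ltW|exact: er|exact: et|exact: es|exact: es'].
have eE : (1 / 200) ^+ 2 = e by [].
clearbody e r t s.
(* Each premise bounds $\epsilon$ by [e] for one of the three parallelograms;
   in the second, the term $rt$ of $(r+s)(s+t)$ is dropped. *)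
have thin01 : r ^+ 2 < e * (r + s) -> ((delta_oct R)%:E < packing_density K)%E.
  move=> lt; apply: (dense_of_thin_hexagon cK circ y0 h0 h1).
    by rewrite /det2 /= mul1r mul0r subr0.
  by rewrite B0 B1 area_eq eE tE; lra.
have thin12 : s ^+ 2 < e * (s + s ^+ 2) -> ((delta_oct R)%:E < packing_density K)%E.
  move=> lt; apply: (dense_of_thin_hexagon cK circ y0 h1 h2).
    by rewrite /det2 /=; field.
  rewrite B1 B2 area_eq eE.
  by have := mulr_gt0 (mulr_gt0 e0 r0) t0; rewrite tE; lra.
have thin23 : t ^+ 2 < e * (s + t) -> ((delta_oct R)%:E < packing_density K)%E.
  move=> lt; apply: (dense_of_thin_hexagon cK circ y0 h2 h3).
    by rewrite /det2 /= mulr0 sub0r mulrN1 opprK.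
  by rewrite B2 B3 area_eq eE rE; lra.
have [re|re] := ltP r e.
  apply: thin01; rewrite expr2 mulrDr.
  have := mulr_gt0 e0 s0; have : r * r < e * r by rewrite ltr_pM2r.
  lra.
have [te|te] := ltP t e.
  apply: thin23; rewrite expr2 mulrDr.
  have := mulr_gt0 e0 s0; have : t * t < e * t by rewrite ltr_pM2r.
  lra.
have [se|se] := ltP s e.
  apply: thin12; rewrite expr2 mulrDr.
  have := mulr_gt0 e0 (mulr_gt0 s0 s0); have : s * s < e * s by rewrite ltr_pM2r.
  lra.
have [es|es] := ltP e^-1 s; last by case: ncore.
apply: thin01.
have : 1 < e * s by rewrite mulrC -ltr_pdivrMr // mul1r.
have : r * r <= 1 by rewrite -[leRHS]mulr1 ler_pM // ?ltW //; lra.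
have := mulr_gt0 e0 r0; rewrite expr2 mulrDr; lra.
Qed.
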